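(* Let $G=(V,E)$ be a finite connected graph with $|V|>2$. Consider either of the following two models. (Independent droppings.) Fix a probability vector $p$ on $V$ with $p(i)>0$ for all $i\in V$. The height process $h(t)=(h_j(t))_{j\in V}\in\mathbb{N}_0^V$ is the Markov chain which at each time step chooses $i\in V$ with probability $p(i)$, independently of the past, and replaces $h$ by $T_ih$. (Markov chain droppings.) Fix an irreducible and lazy transition matrix $A=(A(v,v'))_{v,v'\in V}$ (irreducible: for all $v\neq v'$ there is $s$ with $A^s(v,v')>0$; lazy: $A(v,v)>0$ for all $v$). The process $(h(t),v(t))$ is the Markov chain on $\mathbb{N}_0^V\times V$ which jumps from $(h,v)$ to $(T_{v'}h,v')$ with probability $A(v,v')$. Let $x(t)=(x_i(t))_{i\in V}$ with $x_i(t)=h_i(t)-\max_{j\in V}h_j(t)$ be the height profile seen from the maximum, and $m_V(t)=\max_{j\in V}h_j(t)$. Then: 1. $x(t)$ converges in law to an invariant distribution, independently of the starting configuration. 2. There exists a constant $c>0$, depending on the model, such that for all $t$ and $y>0$, $$\mathbb{P}\big(|m_V(t)-\mathbb{E}\,m_V(t)|>y\big)\le 2\exp\Big(-\frac{c\,y^2}{2t}\Big),$$ where this holds both when $\mathbb{P}=\mathbb{P}_\pi$ is the chain in equilibrium (i.e. started with the profile seen from the maximum, together with the position of the driving chain in the Markov case, distributed according to the invariant distribution) and when the chain is started in any fixed initial configuration. 3. There exists a constant $C$ such that $$\sup_t\big|\mathbb{E}_\pi m_V(t)-\mathbb{E}_0 m_V(t)\big|\le C,$$ where $\mathbb{E}_0$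 denotes expectation for the chain started in the flat configuration $h_j=0$ for all $j\in V$.
   Context: For a configuration $h\in\mathbb{N}_0^V$ and $i\in V$, the particle-adding operator $T_i$ is defined by $(T_ih)_i=\max\{h_k:\operatorname{dist}(k,i)\le 1\}+1$ and $(T_ih)_j=h_j$ for $j\neq i$, where $\operatorname{dist}$ is the graph distance in $G$ (so a particle dropped at $i$ lands on top of the highest particle among $i$ and its neighbours). *)

(* Defs.v *)
From HB Require Import structures.
From mathcomp Require Import all_boot all_order all_algebra.
From mathcomp Require Import all_classical all_reals all_analysis.
Set Implicit Arguments. Unset Strict Implicit. Unset Printing Implicit Defensive.
Import Order.TTheory GRing.Theory Num.Theory.
Local Open Scope ring_scope.

Section Drops.
Variables (V : finType) (e : rel V).

(* Configurations are height vectors h : V -> int (the chain started from a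
   fixed configuration starts in N_0^V, see the theorem). *)

Definition localmax (h : {ffun V -> int}) (i : V) : int :=
  \big[Num.max/h i]_(k | e i k) h k.

Definition Tdrop (i : V) (h : {ffun V -> int}) : {ffun V -> int} :=
  [ffun j => if j == i then localmax h i + 1 else h j].

Definition drops (h : {ffun V -> int}) (s : seq V) : {ffun V -> int} :=
  foldl (fun h i => Tdrop i h) h s.

(* m_V(h) = max_j h_j (the default of the big max is one of the values) *)
Definition mx (h : {ffun V -> int}) : int :=
  \big[Num.max/head 0 (codom h)]_(j : V) h j.

Definition prof (h : {ffun V -> int}) : {ffun V -> int} :=
  [ffun j => h j - mx h].

Variable R : realType.

Definition wI (p : V -> R) (s : seq V) : R := \prod_(i <- s) p i.

Definition PI (p : V -> R) (h0 : {ffun V -> int}) (t : nat)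
  (E : pred {ffun V -> int}) : R :=
  \sum_(s : t.-tuple V) wI p s * (E (drops h0 s))%:R.

Definition ExpI (p : V -> R) (h0 : {ffun V -> int}) (t : nat) : R :=
  \sum_(s : t.-tuple V) wI p s * (mx (drops h0 s))%:~R.

Definition PIpi (pi : {ffun V -> int} -> R) (p : V -> R) (t : nat)
  (E : pred {ffun V -> int}) : \bar R :=
  \esum_(x in [set: {ffun V -> int}]) (pi x * PI p x t E)%:E.

Definition ExpIpi (pi : {ffun V -> int} -> R) (p : V -> R) (t : nat) : \bar R :=
  \esum_(x in [set: {ffun V -> int}]) (pi x * ExpI p x t)%:E.

Definition invariantI (p : V -> R) (pi : {ffun V -> int} -> R) : Prop :=
  forall y : {ffun V -> int},
    \esum_(x in [set: {ffun V -> int}])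
       (pi x * \sum_(i : V) p i * (prof (Tdrop i x) == y)%:R)%:E = (pi y)%:E.

Fixpoint wM (A : V -> V -> R) (v : V) (s : seq V) : R :=
  if s is w :: s' then A v w * wM A w s' else 1.

Definition PM (A : V -> V -> R) (v0 : V) (h0 : {ffun V -> int}) (t : nat)
  (E : pred ({ffun V -> int} * V)) : R :=
  \sum_(s : t.-tuple V) wM A v0 s * (E (drops h0 s, last v0 s))%:R.

Definition ExpM (A : V -> V -> R) (v0 : V) (h0 : {ffun V -> int}) (t : nat) : R :=
  \sum_(s : t.-tuple V) wM A v0 s * (mx (drops h0 s))%:~R.

Definition PMpi (pi : {ffun V -> int} * V -> R) (A : V -> V -> R) (t : nat)
  (E : pred ({ffun V -> int} * V)) : \bar R :=
  \esum_(z in [set: {ffun V -> int} * V]) (pi z * PM A z.2 z.1 t E)%:E.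

Definition ExpMpi (pi : {ffun V -> int} * V -> R) (A : V -> V -> R) (t : nat)
  : \bar R :=
  \esum_(z in [set: {ffun V -> int} * V]) (pi z * ExpM A z.2 z.1 t)%:E.

Definition invariantM (A : V -> V -> R) (pi : {ffun V -> int} * V -> R)
  : Prop :=
  forall (y : {ffun V -> int}) (w : V),
    \esum_(z in [set: {ffun V -> int} * V])
       (pi z * A z.2 w * (prof (Tdrop w z.1) == y)%:R)%:E = (pi (y, w))%:E.

Fixpoint Apow (A : V -> V -> R) (s : nat) (v v' : V) : R :=
  if s is s'.+1 then \sum_(u : V) Apow A s' v u * A u v'
  else (v == v')%:R.

Definition cbound (c y : R) (t : nat) : R :=
  2 * expR (- (c * y ^+ 2 / (2 * t%:R))).

End Drops.

(* Main.v *)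
(** A drop raises the maximum by at most one and commutes with adding a constant
to all heights, so only the profile matters. Let the driving chain tour the
graph often enough for every vertex to be lifted above the old maximum; then all
heights are within a bounded distance of each other. Dropping repeatedly on a
fixed vertex builds a tower so high that a second tour, spreading out from its
top, builds a profile that does not depend on the initial one. Hence some fixed
profile is reached in exactly [L] steps with probability at least [delta > 0]
from every state (Doeblin's condition).

Doeblin's condition contracts oscillations by [1 - delta] every [L] steps, which
gives the invariant law and convergence. It also bounds, uniformly in [t], the
oscillation over starting states of the drift [E m(t) - m(0)]. This is part 3,
and it says that the Doob martingale of [m(t)] has bounded increments, so that
the Azuma-Hoeffding argument gives part 2; in equilibrium the initial state
contributes one more bounded increment. *)
Require Import Defs.
From HB Require Import structures.
From mathcomp Require Import all_boot all_order all_algebra.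
From mathcomp Require Import all_classical all_reals all_analysis.
From mathcomp Require Import zify ring lra.
Import Order.TTheory GRing.Theory Num.Theory numFieldNormedType.Exports.
Local Open Scope ring_scope.
Set Implicit Arguments. Unset Strict Implicit. Unset Printing Implicit Defensive.

(** * Deterministic dynamics *)

Section Heights.
Variables (V : finType) (e : rel V).
Implicit Types (h : {ffun V -> int}) (i j k u v : V) (s : seq V) (S : {set V}).

Local Notation nb := (fun i k => (k == i) || e i k).

Lemma localmax_ge h i k : nb i k -> h k <= localmax e h i.
Proof.
rewrite /localmax => /orP[/eqP->|ik]; first exact: bigmax_ge_id.
exact: le_bigmax_cond.
Qed.

Lemma localmax_attained h i : exists2 k, nb i k & localmax e h i = h k.
Proof.
rewrite /localmax; elim/big_ind: _ => [|x y [k ik ->] [l il ->]|k ik].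
- by exists i; rewrite ?eqxx.
- by case: (leP (h k) (h l)) => _; [exists l|exists k].
- by exists k; rewrite ?ik ?orbT.
Qed.

Lemma localmax_le h i a : (forall k, nb i k -> h k <= a) -> localmax e h i <= a.
Proof. by move=> ha; have [k ik ->] := localmax_attained h i; exact: ha. Qed.

Lemma le_mx h j : h j <= mx h.
Proof. exact: le_bigmax_cond. Qed.

(** The default of the big maximum is the head of [codom h], a genuine height as soon as there is a
    vertex [v]. *)
Lemma mx_attained (v : V) h : exists m, mx h = h m.
Proof.
rewrite /mx; elim/big_ind: _ => [|x y [k ->] [l ->]|k _]; last by exists k.
  have : h v \in codom h by exact: codom_f.
  case E : (codom h) => [|a s]//= _.
  by have /codomP[m ->] : a \in codom h by [rewrite E mem_head]; exists m.
by case: (leP (h k) (h l)) => _; [exists l|exists k].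
Qed.

Lemma le_drops h s j : h j <= drops e h s j.
Proof.
elim: s h => //= i s IH h; apply: le_trans (IH _); rewrite ffunE.
case: eqP => [->|//]; have := @localmax_ge h i i; rewrite eqxx => /(_ isT); lia.
Qed.

Lemma drops_cat h s s' : drops e h (s ++ s') = drops e (drops e h s) s'.
Proof. exact: foldl_cat. Qed.

Lemma mx_Tdrop_le h i : mx (Tdrop e i h) <= mx h + 1.
Proof.
have [m ->] := mx_attained i (Tdrop e i h); rewrite ffunE; case: eqP => _.
  by have [k _ ->] := localmax_attained h i; have := le_mx h k; lia.
by have := le_mx h m; lia.
Qed.

Lemma le_mx_Tdrop h i : mx h <= mx (Tdrop e i h).
Proof.
have [m ->] := mx_attained i h; apply: le_trans (le_mx _ m).
exact: (le_drops h [:: i]).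
Qed.

Lemma mx_drops_le h s : mx (drops e h s) <= mx h + (size s)%:Z.
Proof.
elim: s h => [|i s IH] h /=; first by lia.
by have := IH (Tdrop e i h); have := mx_Tdrop_le h i; lia.
Qed.

Lemma drops_nseq_ge h i n : h i + n%:Z <= drops e h (nseq n i) i.
Proof.
elim: n h => [|n IH] h /=; first by lia.
have := IH (Tdrop e i h); rewrite ffunE eqxx.
by have := @localmax_ge h i i; rewrite eqxx => /(_ isT); lia.
Qed.

Lemma drops_nseq_neq h i n j : j != i -> drops e h (nseq n i) j = h j.
Proof. by move=> /negbTE ji; elim: n h => [|n IH] h //=; rewrite IH ffunE ji. Qed.

(** * Invariance under adding a constant to all heights *)

Definition shift (d : int) h : {ffun V -> int} := [ffun j => h j + d].

Lemma mx_shift (v : V) d h : mx (shift d h) = mx h + d.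
Proof.
have [m hm] := mx_attained v h; have [m' hm'] := mx_attained v (shift d h).
have := le_mx h m'; have := le_mx (shift d h) m; rewrite hm' hm !ffunE; lia.
Qed.

Lemma prof_shift d h : prof (shift d h) = prof h.
Proof. by apply/ffunP => v; rewrite !ffunE (mx_shift v); lia. Qed.

Lemma Tdrop_shift i d h : Tdrop e i (shift d h) = shift d (Tdrop e i h).
Proof.
apply/ffunP => j; rewrite !ffunE; case: eqP => // _.
suff -> : localmax e (shift d h) i = localmax e h i + d by lia.
have [k ik E] := localmax_attained h i.
have [k' ik' E'] := localmax_attained (shift d h) i.
have := localmax_ge h ik'; have := localmax_ge (shift d h) ik.
rewrite E' E !ffunE; lia.
Qed.

Lemma prof_shiftE h : prof h = shift (- mx h) h.
Proof. by apply/ffunP => j; rewrite !ffunE. Qed.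

Lemma mx_prof (v : V) h : mx (prof h) = 0.
Proof. by rewrite prof_shiftE (mx_shift v); lia. Qed.

Lemma prof_id h : prof (prof h) = prof h.
Proof. by have := prof_shift (- mx h) h; rewrite -prof_shiftE. Qed.

(** Together with [mx_Tdrop_prof], this makes the profile evolve on its own, and the rise of the
    maximum a function of profile and drop. *)
Lemma prof_Tdrop_prof i h : prof (Tdrop e i (prof h)) = prof (Tdrop e i h).
Proof. by rewrite (prof_shiftE h) Tdrop_shift prof_shift. Qed.

Lemma mx_Tdrop_prof i h : mx (Tdrop e i (prof h)) = mx (Tdrop e i h) - mx h.
Proof. by rewrite (prof_shiftE h) Tdrop_shift (mx_shift i). Qed.

(* [S] is a set of vertices whose heights are under control; a drop at a
   neighbour of [S] brings that vertex under control. *)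
Definition grow S u := if [exists i in S, nb u i] then u |: S else S.

Lemma sub_grow S u : S \subset grow S u.
Proof. by rewrite /grow; case: ifP => // _; exact: finset.subsetUr. Qed.

Lemma sub_foldl_grow S s : S \subset foldl grow S s.
Proof.
elim: s S => //= u s IH S; exact: fintype.subset_trans (sub_grow S u) (IH _).
Qed.

Lemma mem_foldl_grow S s u i :
  u \in s -> i \in S -> nb u i -> u \in foldl grow S s.
Proof.
move=> us iS ui; elim: s S iS us => //= a s IH S iS; rewrite inE.
case: (eqVneq u a) => [<- _|_ /=]; last first.
  by apply: IH; exact: (fintype.subsetP (sub_grow S a)).
apply: (fintype.subsetP (sub_foldl_grow _ s)); rewrite /grow ifT ?finset.setU11//.
by apply/exists_inP; exists i.
Qed.

(** * Covering a connected graph, and forgetting the initial heights *)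

Hypotheses (e_sym : symmetric e) (e_conn : forall x y : V, connect e x y).

(** A path from inside [S] to a vertex outside has a first edge leaving [S]; symmetry of [e] turns
    this edge around. *)
Lemma grow_boundary S : S != finset.set0 -> S != [set: V]%SET ->
  exists2 u, u \notin S & exists2 i, i \in S & e u i.
Proof.
move=> /finset.set0Pn[a aS] /eqP SV.
have [b bS] : exists b, b \notin S.
  apply/existsP; rewrite -negb_forall; apply/negP => /forallP SA.
  by apply: SV; apply/finset.setP => x; rewrite inE SA.
have /connectP[p pth E] := e_conn a b; rewrite {}E in bS.
elim: p a aS pth bS => [a aS _ /=|c p IH a aS /= /andP[ac pc]]; first by rewrite aS.
have [cS|cS _] := boolP (c \in S); first exact: IH.
by exists c => //; exists a => //; rewrite e_sym.
Qed.

(** Unless [S] is already everything, a round through all vertices absorbs the boundary vertex given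
    by [grow_boundary]. Hence [#|V|] rounds exhaust the graph. *)
Lemma card_grow_round S s : S != finset.set0 -> (forall u, u \in s) ->
  (minn #|V| #|S|.+1 <= #|foldl grow S s|)%N.
Proof.
move=> S0 sV; have [SV|SV] := eqVneq S [set: V]%SET.
  apply: leq_trans (geq_minl _ _) _; rewrite -cardsT -{1}SV.
  exact: subset_leq_card (sub_foldl_grow _ _).
have [u uS [i iS ui]] := grow_boundary S0 SV.
apply: leq_trans (geq_minr _ _) _; apply: proper_card; apply/properP; split.
  exact: sub_foldl_grow.
by exists u => //; apply: (mem_foldl_grow (sV u) iS); rewrite ui orbT.
Qed.

Lemma grow_rounds S s : S != finset.set0 -> (forall u, u \in s) ->
  foldl grow S (flatten (nseq #|V| s)) = [set: V]%SET.
Proof.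
move=> S0 sV; suff H n S' : S' != finset.set0 ->
    (minn #|V| (#|S'| + n) <= #|foldl grow S' (flatten (nseq n s))|)%N.
  apply/eqP; rewrite eqEcard finset.subsetT cardsT; apply: leq_trans (H _ _ S0).
  by rewrite leq_min leqnn leq_addl.
elim: n S' => [|n IH] S' S'0 /=; first by rewrite addn0 geq_minr.
rewrite foldl_cat; apply: leq_trans (IH _ _); last first.
  case/finset.set0Pn: S'0 => x xS; apply/finset.set0Pn; exists x.
  exact: (fintype.subsetP (sub_foldl_grow _ _)).
have := card_grow_round S'0 sV.
by move: #|foldl grow S' s| #|S'| #|V| => a b c; lia.
Qed.

(** A drop next to [S] lands above a vertex of height at least [H], and no drop lowers a vertex. *)
Lemma drops_high h s S H : (forall j, j \in S -> H <= h j) ->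
  forall j, j \in foldl grow S s -> H <= drops e h s j.
Proof.
elim: s h S => //= u s IH h S HS; apply: IH => j; rewrite /grow ffunE.
case: ifPn => [/exists_inP[i iS ui]|_] jS; case: eqP jS => [->|].
- by move=> _; have := HS _ iS; have := localmax_ge h ui; lia.
- by move=> /eqP ju; rewrite in_setU1 (negbTE ju) => /HS.
- by move=> /HS; have := @localmax_ge h u u; rewrite eqxx => /(_ isT); lia.
- by move=> _ /HS.
Qed.

(* [h] and [h'] agree on [S] up to a constant, and [S] towers over its
   complement by so much that [n] drops cannot reveal what lies outside. *)
Definition agree (d : int) (n : nat) S h h' :=
  [/\ forall j, j \in S -> h' j = h j + d,
      forall i j, i \in S -> j \notin S -> h j + n%:Z <= h i &
      forall i j, i \in S -> j \notin S -> h' j + n%:Z <= h' i].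

(** The neighbour [i] in [S] is at least as high as everything outside [S], in both configurations.
    Both maxima are therefore decided inside [S], where the heights differ by [d]. *)
Lemma agree_localmax d n S h h' u i : agree d n S h h' -> i \in S -> nb u i ->
  localmax e h' u = localmax e h u + d.
Proof.
move=> [A B C] iS ui; apply/eqP; rewrite eq_le; apply/andP; split.
  apply: localmax_le => k uk; have [kS|kS] := boolP (k \in S).
    by rewrite A//; have := localmax_ge h uk; lia.
  by have := C _ _ iS kS; have := localmax_ge h ui; have := A _ iS; lia.
suff : localmax e h u <= localmax e h' u - d by lia.
apply: localmax_le => k uk; have [kS|kS] := boolP (k \in S).
  by have := localmax_ge h' uk; rewrite A//; lia.
by have := B _ _ iS kS; have := localmax_ge h' ui; have := A _ iS; lia.
Qed.

Lemma margin_in n S h u i : (forall i j, i \in S -> j \notin S -> h j + n.+1%:Z <= h i) ->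
  i \in S -> nb u i -> 
  forall k j, k \in u |: S -> j \notin u |: S -> 
    Tdrop e u h j + n%:Z <= Tdrop e u h k.
Proof.
move=> B iS ui k j; rewrite !in_setU1 negb_or => kS /andP[/negbTE ju jS].
rewrite !ffunE ju; case: eqP kS => [_ _|_ /= kS]; last by have := B _ _ kS jS; lia.
by have := B _ _ iS jS; have := localmax_ge h ui; lia.
Qed.

(** The drop lands one above some vertex outside [S], which costs one unit of the margin. *)
Lemma margin_out n S h u : (forall i j, i \in S -> j \notin S -> h j + n.+1%:Z <= h i) ->
  ~~ [exists i in S, nb u i] ->
  forall k j, k \in S -> j \notin S -> Tdrop e u h j + n%:Z <= Tdrop e u h k.
Proof.
move=> B uS k j kS jS; rewrite !ffunE.
have out l : nb u l -> l \notin S.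
  move=> ul; apply: contra uS => lS; apply/exists_inP; by exists l.
have -> : (k == u) = false.
  by apply/negP => /eqP E; have := out u; rewrite eqxx -E kS => /(_ isT).
case: eqP => _; last by have := B _ _ kS jS; lia.
by have [l /out lS ->] := localmax_attained h u; have := B _ _ kS lS; lia.
Qed.

Lemma agree_Tdrop d n S h h' u : agree d n.+1 S h h' ->
  agree d n (grow S u) (Tdrop e u h) (Tdrop e u h').
Proof.
move=> AG; have [A B C] := AG; rewrite /grow; case: ifPn => uS.
  have /exists_inP[i iS ui] := uS; split.
  - move=> j; rewrite in_setU1 !ffunE; case: eqP => [_ _|_ /= /A //].
    by rewrite (agree_localmax AG iS ui); lia.
  - exact: margin_in B iS ui.
  - exact: margin_in C iS ui.
split; [|exact: margin_out B uS|exact: margin_out C uS].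
move=> j jS; rewrite !ffunE; case: eqP => [E|_]; last exact: A.
by case/exists_inP: uS; exists j => //; rewrite E eqxx.
Qed.

Lemma agree_drops d s S h h' : agree d (size s) S h h' ->
  agree d 0 (foldl grow S s) (drops e h s) (drops e h' s).
Proof. by elim: s S h h' => //= u s IH S h h' /agree_Tdrop/IH. Qed.

Variables (v0 : V) (C : seq V).
Hypothesis covC : forall m : V, foldl grow [set m]%SET C = [set: V]%SET.

(* After the first tour of [C] all heights differ by at most
   [size s + size C]; the drops at [v0] then make it a tower whose top alone
   determines what the second tour builds. *)
Lemma prof_universal h h' s s' : size s = size s' ->
  let w := C ++ nseq (size s + 2 * size C) v0 ++ C in
  prof (drops e h (s ++ w)) = prof (drops e h' (s' ++ w)).
Proof.
move=> ss' w.
(* After the first tour all heights lie between [mx g] and [mx g + size s + size C]. So [K] drops at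
   [v0] put it at least [size C] above every other vertex, the margin needed for a second tour of
   that length. *)
pose K := (size s + 2 * size C)%N.
pose t g r := drops e g (r ++ C ++ nseq K v0).
have tower g r : size r = size s -> forall j, j != v0 ->
    t g r j + (size C)%:Z <= t g r v0.
  move=> rs j jv; rewrite /t catA drops_cat; set g1 := drops e g (r ++ C).
  (* The tour grows from a vertex [m] where [g] is maximal, and carries the height [mx g] to every
     vertex. *)
  have lo i : mx g <= g1 i.
    have [m ->] := mx_attained v0 g; rewrite /g1 drops_cat.
    apply: (@drops_high _ C [set m]%SET) => [k|]; last by rewrite covC inE.
    by rewrite inE => /eqP->; exact: le_drops.
  have hi i : g1 i <= mx g + (size s + size C)%:Z.
    by apply: le_trans (le_mx _ i) _; rewrite -rs -size_cat; exact: mx_drops_le.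
  rewrite (drops_nseq_neq _ _ jv).
  have := drops_nseq_ge g1 v0 K; have := lo v0; have := hi j; rewrite /K; lia.
set d := t h' s' v0 - t h s v0.
(* Only the tops of the towers are matched, with offset [d]; the second tour propagates this
   agreement to all of [V]. *)
have : agree d (size C) [set v0]%SET (t h s) (t h' s').
  split => [j|i j|i j]; rewrite !inE => /eqP->; first by rewrite /d; lia.
    exact: tower.
  by apply: tower.
move=> /agree_drops; rewrite covC => -[E _ _].
have split_w g r : drops e g (r ++ w) = drops e (t g r) C.
  by rewrite /t -drops_cat /w -!catA.
rewrite !split_w; suff -> : drops e (t h' s') C = shift d (drops e (t h s) C).
  by rewrite prof_shift.
by apply/ffunP => j; rewrite E ?inE// ffunE.
Qed.

End Heights.

(** * Admissible words leading every state to one fixed profile *)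

Section Words.
Variables (V : finType) (e a : rel V).
Hypotheses (e_sym : symmetric e) (e_conn : forall x y : V, connect e x y).
Hypotheses (a_refl : reflexive a) (a_conn : forall x y : V, connect a x y).

Lemma path_nseq x n : path a x (nseq n x).
Proof. by elim: n => //= n ->; rewrite a_refl. Qed.

Lemma last_nseq (x : V) n : last x (nseq n x) = x.
Proof. by elim: n. Qed.

(** A path without repeated vertices has fewer than [#|V|] steps; waiting at [x], allowed by
    [a_refl], pads it to a length common to all pairs. *)
Lemma exists_walk x y : exists s, [/\ size s = #|V|, path a x s & last x s = y].
Proof.
have /connectP[p pp ->] := a_conn x y; case/shortenP: pp => p' pp' up' _.
have lt : (size p' < #|V|)%N.
  by rewrite -[(size p').+1]/(size (x :: p')) -(card_uniqP up') max_card.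
exists (nseq (#|V| - size p') x ++ p'); split.
- by rewrite size_cat size_nseq subnK// ltnW.
- by rewrite cat_path path_nseq last_nseq.
- by rewrite last_cat last_nseq.
Qed.

Definition loop x s := path a x s && (last x s == x).

Lemma loop_cat x s s' : loop x s -> loop x s' -> loop x (s ++ s').
Proof.
by move=> /andP[ps /eqP ls] /andP[ps' ls']; rewrite /loop cat_path last_cat ps ls ps'.
Qed.

Lemma loop_flatten x ss : all (loop x) ss -> loop x (flatten ss).
Proof.
elim: ss => [|s ss IH] /=; first by rewrite /loop /= eqxx.
by move=> /andP[xs /IH]; exact: loop_cat.
Qed.

Lemma exists_covering_loop (v0 : V) : exists C, loop v0 C /\
  forall m : V, foldl (grow e) [set m]%SET C = [set: V]%SET.
Proof.
have /choice[w hw] (xy : V * V) := exists_walk xy.1 xy.2.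
(* One round: from [v0] to each [u] and back. *)
pose C := flatten [seq w (v0, u) ++ w (u, v0) | u <- enum V].
exists (flatten (nseq #|V| C)); split.
  apply/loop_flatten/allP => _ /nseqP[-> _].
  apply/loop_flatten/allP => _ /mapP[u _ ->]; rewrite /loop cat_path last_cat.
  have [_ /= -> ->] := hw (v0, u); have [_ /= -> ->] := hw (u, v0).
  by rewrite eqxx.
move=> m; apply: grow_rounds => // [|u].
  by apply/finset.set0Pn; exists m; rewrite inE.
apply/flattenP; exists (w (v0, u) ++ w (u, v0)).
  by apply: map_f; rewrite mem_enum.
(* The endpoint [u] occurs in a nonempty walk to it, and the walk has length [#|V| > 0]. *)
rewrite mem_cat; have [/= sz _ lst] := hw (v0, u); move: sz lst.
case: (w (v0, u)) => [/= z _|b s /= _ <-]; last by rewrite mem_last.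
by have := max_card (pred1 m); rewrite card1 -z.
Qed.

(** A first leg of length [#|V|] brings the driving chain to [v0]; then the word of [prof_universal]
    is played. Its result depends neither on [h] nor on the first leg, so the flat configuration can
    serve to name it. *)
Lemma exists_universal_words (v0 : V) : exists L x, (0 < L)%N /\ forall h v, exists s,
  [/\ size s = L, path a v s, last v s = v0 & prof (drops e h s) = x].
Proof.
have [C [/andP[pC /eqP lC] covC]] := exists_covering_loop v0.
pose K := (#|V| + 2 * size C)%N; pose w := C ++ nseq K v0 ++ C.
have [s0 [sz0 _ _]] := exists_walk v0 v0.
exists (#|V| + size w)%N; exists (prof (drops e [ffun=> 0] (s0 ++ w))).
split=> [|h v]; first by rewrite addn_gt0; apply/orP; left; apply/card_gt0P; exists v0.
have [s [sz ps ls]] := exists_walk v v0.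
exists (s ++ w); split.
- by rewrite size_cat sz.
- by rewrite /w !cat_path ps ls pC lC path_nseq last_nseq pC.
- by rewrite /w !last_cat ls lC last_nseq.
- have ss : size s = size s0 by rewrite sz sz0.
  by have := prof_universal v0 covC h [ffun=> 0] ss; rewrite sz.
Qed.

End Words.

(** * Two analytic tools *)

Lemma esum_eq_lim (R : realType) (T : choiceType) (a : T -> R) (l : R) :
  (forall s : seq T, uniq s -> \sum_(x <- s) a x <= l) ->
  (forall eps, 0 < eps -> exists2 s : seq T, uniq s & l - eps <= \sum_(x <- s) a x) ->
  (\esum_(x in [set: T]%classic) (a x)%:E = l%:E)%E.
Proof.
move=> hu hl; apply/eqP; rewrite eq_le; apply/andP; split.
  apply: ge_ereal_sup => _ [A [finA _] <-].
  by rewrite fsbig_finite// sumEFin lee_fin; apply: hu; exact: finmap.fset_uniq.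
apply/lee_addgt0Pr => eps eps0; have [s us ls] := hl _ eps0.
apply: (@le_trans _ _ ((\sum_(x <- s) a x)%:E + eps%:E)%E).
  by rewrite -EFinD lee_fin; lra.
apply: leeD2r; apply: esum_ge; exists [set` s]%classic.
  by split => //; exact: finite_seq.
by rewrite -fsbig_seq// sumEFin.
Qed.

(** For [x <= 1/2], [e^x <= 1 / (1 - x) <= 1 + x + 2 x^2], and [1 + 2 x^2 <= e^(2 x^2)]. For
    [x > 1/2], already [x <= 2 x^2]. *)
Lemma expR_le_id_sqr (R : realType) (x : R) : expR x <= x + expR (2 * x ^+ 2).
Proof.
have [x2|x2] := leP x (1 / 2).
  apply: (@le_trans _ _ (x + (1 + 2 * x ^+ 2))); last by rewrite lerD2l expR_ge1Dx.
  have : expR x * (1 - x) <= 1.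
    rewrite -[leRHS](@expR0 R) -(subrr x) expRD ler_pM2l ?expR_gt0//; exact: expR_ge1Dx.
  have := expR_gt0 x; nra.
apply: (@le_trans _ _ (expR (2 * x ^+ 2))); last by lra.
by rewrite ler_expR; nra.
Qed.

(** * Doeblin chains *)

(* A chain with a finite set [V] of moves: from [z] the move [w] is made with
   probability [wt z w]. [P t f z] is the expectation of [f] after [t] steps from
   [z]. An idempotent [red] maps a state to its profile, and laws on profiles are
   encoded as laws on states carried by the fixed points of [red]. *)
Section Chain.
Variables (R : realType) (Z : choiceType) (V : finType).
Variables (step : Z -> V -> Z) (wt : Z -> V -> R).
Implicit Types (f g : Z -> R) (z x : Z) (w : V) (t n : nat) (s : seq Z).

Definition U f z : R := \sum_(w : V) wt z w * f (step z w).
Definition P t f : Z -> R := iter t U f.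

Hypothesis wt_ge0 : forall z w, 0 <= wt z w.
Hypothesis wt_sum1 : forall z, \sum_(w : V) wt z w = 1.

Lemma P_S t f z : P t.+1 f z = \sum_(w : V) wt z w * P t f (step z w).
Proof. by []. Qed.

Lemma P_D t n f : P (t + n) f = P t (P n f).
Proof. exact: iterD. Qed.

Lemma P_le t f g : (forall z, f z <= g z) -> forall z, P t f z <= P t g z.
Proof.
move=> fg; elim: t => [|t IH] z; first exact: fg.
rewrite !P_S; apply: ler_sum => w _.
by apply: ler_wpM2l.
Qed.

Lemma P_lin t a b f g z :
  P t (fun z => a * f z + b * g z) z = a * P t f z + b * P t g z.
Proof.
elim: t z => // t IH z; rewrite !P_S !mulr_sumr -big_split /=.
by apply: eq_bigr => w _; rewrite IH; ring.
Qed.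

Lemma P_ext t f g : f =1 g -> P t f =1 P t g.
Proof.
move=> fg; elim: t => [|t IH] z; first exact: fg.
by rewrite !P_S; apply: eq_bigr => w _; rewrite IH.
Qed.

Lemma P_cst t a z : P t (fun=> a) z = a.
Proof.
elim: t z => // t IH z; rewrite P_S.
by under eq_bigr do rewrite IH; rewrite -mulr_suml wt_sum1 mul1r.
Qed.

Lemma P_affine t a b f z : P t (fun z => a + b * f z) z = a + b * P t f z.
Proof.
have := P_lin t a b (fun=> 1) f z; rewrite P_cst !mulr1 => <-.
by apply: P_ext.
Qed.

Lemma P_sum (I : Type) (r : seq I) (c : I -> R) (g : I -> Z -> R) t z :
  P t (fun z => \sum_(i <- r) c i * g i z) z = \sum_(i <- r) c i * P t (g i) z.
Proof.
elim: r => [|i r IH].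
  by rewrite big_nil -[RHS](P_cst t 0 z); apply: P_ext => y; rewrite big_nil.
have := P_lin t (c i) 1 (g i) (fun z => \sum_(i <- r) c i * g i z) z.
rewrite big_cons -IH mul1r => <-.
by apply: P_ext => y; rewrite big_cons mul1r.
Qed.

Lemma P_ub t f b : (forall z, f z <= b) -> forall z, P t f z <= b.
Proof. by move=> fb z; have := @P_le t f (fun=> b) fb z; rewrite P_cst. Qed.

Lemma P_lb t f a : (forall z, a <= f z) -> forall z, a <= P t f z.
Proof. by move=> fa z; have := @P_le t (fun=> a) f fa z; rewrite P_cst. Qed.

Lemma P_range t f a b : (forall z, a <= f z <= b) -> forall z, a <= P t f z <= b.
Proof.
by move=> fab z; rewrite P_lb ?P_ub// => y; have /andP[] := fab y.
Qed.

(* Hoeffding's lemma with a crude constant, from [e^x <= x + e^(2 x^2)]. *)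
Lemma U_expR f z (K lam : R) : (forall w, `|f (step z w) - U f z| <= K) ->
  U (fun y => expR (lam * f y)) z <= expR (lam * U f z + 2 * lam ^+ 2 * K ^+ 2).
Proof.
move=> hK; rewrite expRD.
apply: (@le_trans _ _ (\sum_(w : V) wt z w * (expR (lam * U f z) *
   (lam * (f (step z w) - U f z) + expR (2 * lam ^+ 2 * K ^+ 2))))).
  apply: ler_sum => w _; apply: ler_wpM2l => //.
  have -> : lam * f (step z w) = lam * U f z + lam * (f (step z w) - U f z) by ring.
  rewrite expRD ler_pM2l ?expR_gt0//; apply: le_trans (expR_le_id_sqr _) _.
  rewrite lerD2l ler_expR exprMn mulrA; apply: ler_wpM2l.
    by apply: mulr_ge0 => //; exact: sqr_ge0.
  have := hK w; rewrite ler_norml; move: (_ - _) => d /andP[h1 h2].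
  by have : 0 <= (K - d) * (K + d) by [apply: mulr_ge0; lra]; nra.
(* What remains is an equality: the linear term is centred, so its average vanishes. *)
rewrite le_eqVlt; apply/orP; left; apply/eqP.
set E := expR (lam * _); set q := expR _; set u := U f z.
transitivity (E * (lam * (\sum_(w : V) wt z w * f (step z w) -
    \sum_(w : V) wt z w * u) + \sum_(w : V) wt z w * q)).
  rewrite -sumrB mulr_sumr -big_split mulr_sumr /=.
  by apply: eq_bigr => w _; ring.
by rewrite -!mulr_suml wt_sum1 -[X in X - _]/u; ring.
Qed.

Fixpoint admissible z (s : seq V) : bool :=
  if s is w :: s' then (0 < wt z w) && admissible (step z w) s' else true.

(** Only the trajectory [s] is kept, each of whose moves has probability at least [eps]. *)
Lemma P_admissible f (eps : R) z (s : seq V) : 0 <= eps ->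
  (forall z w, 0 < wt z w -> eps <= wt z w) -> (forall z, 0 <= f z) ->
  admissible z s -> eps ^+ size s * f (foldl step z s) <= P (size s) f z.
Proof.
move=> eps0 heps f0; elim: s z => [|w s IH] z; first by rewrite /= mul1r.
move=> /andP[zw adm]; rewrite [size _]/= [foldl _ _ _]/= P_S (bigD1 w)//=.
rewrite -[leLHS]addr0; apply: lerD.
  rewrite exprS -mulrA; apply: ler_pM => //; last exact: IH.
  - by rewrite mulr_ge0// exprn_ge0.
  - exact: heps.
by apply: sumr_ge0 => w' _; rewrite mulr_ge0//; exact: P_lb.
Qed.

(** * Passage to profiles and contraction under Doeblin's condition *)

Variables (red : Z -> Z).
Hypothesis wt_red : forall z w, wt (red z) w = wt z w.
Hypothesis step_red : forall z w, red (step (red z) w) = red (step z w).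
Hypothesis red_id : forall z, red (red z) = red z.

Definition inv f := forall z, f (red z) = f z.
Definition ind x z : R := (red z == x)%:R.

Lemma inv_P t f : inv f -> inv (P t f).
Proof.
move=> fi; elim: t => // t IH z; rewrite !P_S; apply: eq_bigr => w _.
by rewrite wt_red -[in LHS]IH step_red IH.
Qed.

Lemma inv_ind x : inv (ind x).
Proof. by move=> z; rewrite /ind red_id. Qed.

Lemma ind_range x z : 0 <= ind x z <= 1.
Proof. by rewrite /ind ler0n lern1 leq_b1. Qed.

Variables (L : nat) (delta : R) (zs : Z).
Hypothesis L_gt0 : (0 < L)%N.
Hypothesis delta_gt0 : 0 < delta.
Hypothesis doeblin : forall z, delta <= P L (ind zs) z.

Lemma delta_le1 : delta <= 1.
Proof.
by apply: le_trans (doeblin zs) _; have /andP[] := P_range L (ind_range zs) zs.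
Qed.

(** With probability at least [delta] the profile after [L] steps is [zs], where [f] takes the value
    [f zs]. Both bounds thus move towards [f zs] by the fraction [delta]. *)
Lemma contract f a b : inv f -> (forall z, a <= f z <= b) ->
  exists a' b', b' - a' = (1 - delta) * (b - a) /\ forall z, a' <= P L f z <= b'.
Proof.
move=> fi fab; exists (a + (f zs - a) * delta), (b + (f zs - b) * delta).
split => [|z]; first by ring.
have eqf y : red y = zs -> f y = f zs by move=> <-; rewrite fi.
have /andP[fa fb] := fab zs; have d := doeblin z; apply/andP; split.
  apply: (@le_trans _ _ (a + (f zs - a) * P L (ind zs) z)); first by nra.
  rewrite -P_affine; apply: P_le => y; rewrite /ind.
  by case: eqP => [/eqf ->|_] /=; have /andP[] := fab y; lra.
apply: (@le_trans _ _ (b + (f zs - b) * P L (ind zs) z)); last by nra.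
rewrite -P_affine; apply: P_le => y; rewrite /ind.
by case: eqP => [/eqf ->|_] /=; have /andP[] := fab y; lra.
Qed.

Lemma contract_iter n f a b : inv f -> (forall z, a <= f z <= b) ->
  exists a' b', b' - a' = (1 - delta) ^+ n * (b - a) /\
    forall t z, (n * L <= t)%N -> a' <= P t f z <= b'.
Proof.
elim: n f a b => [|n IH] f a b fi fab.
  by exists a, b; split=> [|t z _]; [rewrite expr0 mul1r|exact: P_range].
have [a1 [b1 [E1 /(IH _ _ _ (inv_P L fi)) [a2 [b2 [E2 H2]]]]]] := contract fi fab.
exists a2, b2; split=> [|t z nt]; first by rewrite E2 E1 exprSr mulrA.
have Lt : (L <= t)%N by apply: leq_trans nt; rewrite mulSn leq_addr.
by rewrite -(subnK Lt) P_D; apply: H2; rewrite leq_subRL// -mulSn.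
Qed.

Lemma contract_small (B eps : R) : 0 < eps -> exists n, (1 - delta) ^+ n * B < eps.
Proof.
move=> eps0; have d0 := delta_gt0; have d1 := delta_le1.
have : `|1 - delta| < 1 by rewrite ltr_norml; apply/andP; split; lra.
move/cvg_expr/cvgrPdist_lt => /(_ (eps / (`|B| + 1))) [].
  by rewrite divr_gt0// ltr_wpDl.
move=> n _ /(_ n (leqnn n)); rewrite sub0r normrN => h; exists n.
apply: le_lt_trans (ler_norm _) _; rewrite normrM.
have h' := h; rewrite ltr_pdivlMr in h'; last by rewrite ltr_wpDl.
apply: le_lt_trans h'; rewrite ler_wpM2l//; lra.
Qed.

(** * The limit law *)

Definition bnd f := exists B, forall z, `|f z| <= B.

(** This is the equilibrium expectation, as [esum_pi] shows. The start [zs] is a mere choice: by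
    [cvg_P] every start gives the same limit for bounded functions of the profile. *)
Definition mu f : R := lim (P t f zs @[t --> \oo])%classic.

Lemma bnd_range f : bnd f -> exists a b, forall z, a <= f z <= b.
Proof. by move=> [B hB]; exists (- B), B => z; rewrite -ler_norml. Qed.

Lemma range_bnd f a b : (forall z, a <= f z <= b) -> bnd f.
Proof.
move=> fab; exists (`|a| + `|b|) => z; rewrite ler_norml.
have /andP[] := fab z; have := ler_norm b; have := ler_norm (- a).
by rewrite normrN; have := normr_ge0 a; have := normr_ge0 b; lra.
Qed.

Lemma bnd_near f eps : bnd f -> inv f -> 0 < eps -> exists a b n, b - a < eps /\
  forall t z, (n <= t)%N -> a <= P t f z <= b.
Proof.
move=> /bnd_range[a [b fab]] fi /(contract_small (b - a))[n hn].
have [a' [b' [E H]]] := contract_iter n fi fab.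
by exists a', b', (n * L)%N; split=> //; rewrite E.
Qed.

Lemma is_cvg_P f : bnd f -> inv f -> cvg (P t f zs @[t --> \oo])%classic.
Proof.
move=> fb fi; apply: cauchy_cvg; apply: cauchy_exP => eps eps0.
have [a [b [n [ab H]]]] := bnd_near fb fi eps0; exists a; exists n => // t nt.
have /andP[h1 h2] := H t zs nt; rewrite /ball /= distrC ger0_norm; lra.
Qed.

Lemma cvg_P f z : bnd f -> inv f -> (P t f z @[t --> \oo] --> mu f)%classic.
Proof.
move=> fb fi; apply/cvgrPdist_lt => eps eps0.
have [a [b [n [ab H]]]] := bnd_near fb fi eps0; exists n => // t nt /=.
have /andP[h1 h2] := H t z nt; have cf := is_cvg_P fb fi.
have l1 : a <= mu f.
  by apply: limr_ge => //; exists n => // k nk; have /andP[] := H k zs nk.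
have l2 : mu f <= b.
  by apply: limr_le => //; exists n => // k nk; have /andP[] := H k zs nk.
by rewrite ltr_norml; apply/andP; split; lra.
Qed.

Lemma mu_eq f l : (P t f zs @[t --> \oo] --> l)%classic -> mu f = l.
Proof. by move=> h; apply: cvg_lim. Qed.

Lemma mu_le f g : bnd f -> inv f -> bnd g -> inv g -> (forall z, f z <= g z) ->
  mu f <= mu g.
Proof.
move=> bf If bg Ig fg; apply: ler_lim; [exact: is_cvg_P..|].
by apply: nearW => t; exact: P_le.
Qed.

Lemma mu_affine f a b : bnd f -> inv f -> mu (fun z => a + b * f z) = a + b * mu f.
Proof.
move=> bf If; apply: mu_eq; under eq_cvg do rewrite P_affine.
by apply: cvgD; [exact: cvg_cst|apply: cvgMr; exact: cvg_P].
Qed.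

Lemma mu_lin f g a b : bnd f -> inv f -> bnd g -> inv g ->
  mu (fun z => a * f z + b * g z) = a * mu f + b * mu g.
Proof.
move=> bf If bg Ig; apply: mu_eq; under eq_cvg do rewrite P_lin.
by apply: cvgD; apply: cvgMr; exact: cvg_P.
Qed.

Lemma mu_U f : bnd f -> inv f -> mu (U f) = mu f.
Proof.
move=> bf If; apply: mu_eq.
have E t : P t (U f) zs = P t.+1 f zs by rewrite /P iterSr.
under eq_cvg do rewrite E.
by have h := cvg_P zs bf If; rewrite -cvg_shiftS in h; exact: h.
Qed.

Definition pi x : R := mu (ind x).

Lemma bnd_ind x : bnd (ind x).
Proof. exact: range_bnd (ind_range x). Qed.

Lemma pi_ge0 x : 0 <= pi x.
Proof.
apply: limr_ge; first by apply: is_cvg_P; [exact: bnd_ind|exact: inv_ind].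
by apply: nearW => t; have /andP[] := P_range t (ind_range x) zs.
Qed.

Lemma cvg_P_sum s (c : Z -> R) :
  (P t (fun z => \sum_(x <- s) c x * ind x z) zs @[t --> \oo] -->
    \sum_(x <- s) c x * pi x)%classic.
Proof.
under eq_cvg do rewrite P_sum.
apply: cvg_big => [|x _]; first exact: add_continuous.
by apply: cvgMr; apply: cvg_P; [exact: bnd_ind|exact: inv_ind].
Qed.

Lemma sum_ind s (c : Z -> R) z : uniq s ->
  \sum_(x <- s) c x * ind x z = (red z \in s)%:R * c (red z).
Proof.
move=> us; have [zin|zin] := boolP (red z \in s).
  rewrite (bigD1_seq (red z))//= /ind eqxx mulr1 mul1r big1 ?addr0// => x.
  by rewrite eq_sym => /negbTE ->; rewrite mulr0.
rewrite mul0r big_seq big1// => x xs; rewrite /ind; case: eqP => [E|]; last by rewrite mulr0.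
by rewrite E xs in zin.
Qed.

(** There are finitely many moves, so only finitely many states are reached in [t] steps. *)
Lemma finite_reach t z : exists s, P t (fun y => (red y \in s)%:R) z = 1.
Proof.
suff [s hs] : exists s, 1 <= P t (fun y => (red y \in s)%:R) z.
  exists s; apply/eqP; rewrite eq_le hs andbT.
  by apply: P_ub => y; rewrite lern1 leq_b1.
elim: t z => [|t IH] z; first by exists [:: red z]; rewrite /P /= mem_head.
have /choice[G hG] w := IH (step z w).
exists (flatten [seq G w | w <- enum V]).
rewrite P_S -[X in X <= _](wt_sum1 z); apply: ler_sum => w _.
rewrite -[X in X <= _]mulr1; apply: ler_wpM2l => //; apply: le_trans (hG w) _.
apply: P_le => y; rewrite /= ler_nat; case: (boolP (_ \in G w)) => // yw.
rewrite lt0b; apply/flattenP; exists (G w) => //.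
by apply: map_f; rewrite mem_enum.
Qed.

(** No mass escapes to infinity. After [L] steps the profile is [zs] with probability at least
    [delta], and from there the finite list [s'] is reached surely; otherwise the previous list [s]
    has probability at least [q]. The new bound is [q + (1 - q) * delta]. *)
Lemma tight n : exists2 s, uniq s &
  forall z, 1 - (1 - delta) ^+ n <= P (n * L) (fun y => (red y \in s)%:R) z.
Proof.
suff [s hs] : exists s, forall z,
    1 - (1 - delta) ^+ n <= P (n * L) (fun y => (red y \in s)%:R) z.
  exists (undup s); first exact: undup_uniq.
  by move=> z; apply: le_trans (hs z) _; apply: P_le => y; rewrite mem_undup.
elim: n => [|n [s hs]].
  by exists [::] => z; rewrite mul0n expr0 subrr ler0n.
have [s' hs'] := finite_reach (n * L) zs.
exists (s ++ s') => z; rewrite mulSn P_D.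
set F := (fun y => (red y \in s ++ s')%:R : R); set g := P (n * L) F.
have Fi : inv F by move=> y; rewrite /F red_id.
have gi : inv g by exact: inv_P.
have g1 : g zs = 1.
  apply/eqP; rewrite eq_le; apply/andP; split.
    by apply: P_ub => y; rewrite lern1 leq_b1.
  rewrite -hs'; apply: P_le => y; rewrite /F mem_cat ler_nat.
  by case: (_ \in s) => //; rewrite leq_b1.
set q := 1 - (1 - delta) ^+ n.
have gq y : q <= g y.
  apply: le_trans (hs y) _; apply: P_le => u.
  by rewrite /F mem_cat ler_nat; case: (_ \in s).
have q1 : q <= 1 by rewrite -g1.
apply: (@le_trans _ _ (q + (1 - q) * delta)); first by rewrite /q exprS; lra.
apply: (@le_trans _ _ (q + (1 - q) * P L (ind zs) z)).
  by have := doeblin z; nra.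
rewrite -P_affine; apply: P_le => y; rewrite /ind.
case: eqP => [E|_] /=; last by have := gq y; lra.
by rewrite -(gi y) E g1; lra.
Qed.

Lemma pi_tight n : exists2 s, uniq s & 1 - (1 - delta) ^+ n <= \sum_(x <- s) pi x.
Proof.
have [s us hs] := tight n; exists s => //.
have -> : \sum_(x <- s) pi x = \sum_(x <- s) 1 * pi x.
  by apply: eq_bigr => x _; rewrite mul1r.
rewrite -(mu_eq (@cvg_P_sum s (fun=> 1))).
apply: limr_ge; first by apply/cvg_ex; eexists; exact: cvg_P_sum.
exists (n * L)%N => // t nt; rewrite /= -(subnK nt) P_D.
apply: P_lb => y; apply: le_trans (hs y) _; rewrite le_eqVlt; apply/orP; left; apply/eqP.
by apply: P_ext => u; rewrite sum_ind// mulr1.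
Qed.

(** Partial sums stay below [mu] since [f] is nonnegative on profiles. By tightness a finite set
    carries all but mass [(1 - delta)^n], which contributes at most [b] times that. *)
Lemma esum_pi f b : (forall z, 0 <= f (red z) <= b) ->
  (\esum_(x in [set: Z]%classic) (pi x * f x)%:E = (mu (f \o red))%:E)%E.
Proof.
move=> fb; have bf : bnd (f \o red) by exact: range_bnd fb.
have If : inv (f \o red) by move=> z; rewrite /= red_id.
have swap s : \sum_(x <- s) pi x * f x = \sum_(x <- s) f x * pi x.
  by apply: eq_bigr => x _; rewrite mulrC.
have cf := is_cvg_P bf If.
apply: esum_eq_lim => [s us|eps eps0].
  rewrite swap; apply: ler_cvg_to (cvg_P_sum (s := s) (c := f)) cf _.
  apply: nearW => t; apply: P_le => z; rewrite sum_ind//=.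
  by case: (_ \in s); rewrite ?mul1r// mul0r; have /andP[] := fb z.
have [n hn] := contract_small b eps0; have [s us hs] := pi_tight n; exists s => //.
have b0 : 0 <= b by have /andP[] := fb zs; exact: le_trans.
(* The majorant equals [f] on [s] and [b] elsewhere. *)
have : mu (f \o red) <= b + 1 * \sum_(x <- s) (f x - b) * pi x.
  have c : (P t (fun z => b + 1 * \sum_(x <- s) (f x - b) * ind x z) zs @[t --> \oo] -->
      b + 1 * \sum_(x <- s) (f x - b) * pi x)%classic.
    under eq_cvg do rewrite P_affine.
    by apply: cvgD; [exact: cvg_cst|apply: cvgMr; exact: cvg_P_sum].
  apply: ler_cvg_to cf c _; apply: nearW => t; apply: P_le => z; rewrite sum_ind//=.
  by case: (_ \in s) => /=; have := fb z; lra.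
have -> : \sum_(x <- s) (f x - b) * pi x =
    \sum_(x <- s) pi x * f x - b * \sum_(x <- s) pi x.
  by rewrite mulr_sumr -sumrB; apply: eq_bigr => x _; ring.
nra.
Qed.

Lemma esum_pi1 : (\esum_(x in [set: Z]%classic) (pi x)%:E = 1)%E.
Proof.
have := @esum_pi (fun=> 1) 1 (fun _ => ltac:(by rewrite ler01 lexx)).
have -> : mu ((fun=> 1) \o red) = 1.
  apply: mu_eq; under eq_cvg do rewrite P_cst; exact: cvg_cst.
by move=> <-; apply: eq_esum => x _; rewrite mulr1.
Qed.

Lemma pi_invariant y :
  (\esum_(x in [set: Z]%classic) (pi x * U (ind y) x)%:E = (pi y)%:E)%E.
Proof.
rewrite (@esum_pi _ 1) => [|z]; last exact: (P_range 1 (ind_range y)).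
have Ii : inv (U (ind y)) by exact: (inv_P 1 (@inv_ind y)).
have -> : U (ind y) \o red = U (ind y) by apply/funext => z; exact: Ii.
by rewrite mu_U//; [exact: bnd_ind|exact: inv_ind].
Qed.

Lemma mu_range f a b : inv f -> (forall z, a <= f z <= b) -> a <= mu f <= b.
Proof.
move=> If fab; have cf := is_cvg_P (range_bnd fab) If; apply/andP; split.
  by apply: limr_ge => //; apply: nearW => t; have /andP[] := P_range t fab zs.
by apply: limr_le => //; apply: nearW => t; have /andP[] := P_range t fab zs.
Qed.

(** Hoeffding's lemma for a profile drawn from equilibrium: [f - mu f] is centred, so the linear
    term of [expR_le_id_sqr] integrates to zero. *)
Lemma mu_expR f (K lam : R) : inv f -> bnd f -> (forall z, `|f z - mu f| <= K) ->
  mu (fun z => expR (lam * (f z - mu f))) <= expR (2 * lam ^+ 2 * K ^+ 2).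
Proof.
move=> If bf fK; set E := expR (2 * _ * _).
have le z : expR (lam * (f z - mu f)) <= E - lam * mu f + lam * f z.
  apply: le_trans (expR_le_id_sqr _) _.
  rewrite [leRHS](_ : _ = lam * (f z - mu f) + E); last by ring.
  rewrite lerD2l ler_expR exprMn mulrA; apply: ler_wpM2l.
    by apply: mulr_ge0 => //; exact: sqr_ge0.
  have := fK z; rewrite ler_norml; move: (_ - _) => d /andP[h1 h2].
  by have : 0 <= (K - d) * (K + d) by [apply: mulr_ge0; lra]; nra.
have [B hB] := bf.
have rg z : - (`|E - lam * mu f| + `|lam| * B) <= E - lam * mu f + lam * f z
    <= `|E - lam * mu f| + `|lam| * B.
  rewrite -ler_norml; apply: le_trans (ler_normD _ _) _.
  by rewrite lerD2l normrM ler_wpM2l.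
have -> : E = E - lam * mu f + lam * mu f by ring.
rewrite -mu_affine//; apply: mu_le => //.
- apply: (range_bnd (a := 0) (b := `|E - lam * mu f| + `|lam| * B)) => z.
  by rewrite expR_ge0 (le_trans (le z))//; have /andP[] := rg z.
- by move=> z; rewrite If.
- exact: range_bnd rg.
- by move=> z; rewrite If.
Qed.

(** * Drift of the maximum *)

Variable m : Z -> int.
Hypothesis m_red : forall z, m (red z) = 0.
Hypothesis m_step_red : forall z w, m (step (red z) w) = m (step z w) - m z.
Hypothesis m_step : forall z w, m z <= m (step z w) <= m z + 1.

Definition mR z : R := (m z)%:~R.
Definition drift t z := P t mR z - mR z.

Lemma mR_step z w : mR z <= mR (step z w) <= mR z + 1.
Proof.
have -> : mR z + 1 = (m z + 1)%:~R by rewrite intrD.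
by rewrite !ler_int; exact: m_step.
Qed.

Lemma P_mR_red t z : P t mR (red z) = P t mR z - mR z.
Proof.
elim: t z => [|t IH] z; first by rewrite /P /= /mR m_red subrr.
rewrite !P_S -[mR z]mul1r -(wt_sum1 z) mulr_suml -sumrB; apply: eq_bigr => w _.
have := IH (step z w); have := IH (step (red z) w).
rewrite wt_red step_red /mR m_step_red intrB => h1 h2.
rewrite (_ : P t _ (step (red z) w) =
    P t (fun z0 : Z => (m z0)%:~R) (step z w) - (m z)%:~R).
  by ring.
by rewrite /mR in h1 h2 *; lra.
Qed.

(** The maximum is not a function of the profile, but its drift is, which makes [contract]
    applicable. *)
Lemma inv_drift t : inv (drift t).
Proof. by move=> z; rewrite /drift P_mR_red /mR m_red subr0. Qed.

Lemma U_range f z a b : (forall w, a <= f (step z w) <= b) -> a <= U f z <= b.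
Proof.
move=> fab; rewrite -[a]mul1r -[b]mul1r -(wt_sum1 z) !mulr_suml.
apply/andP; split; apply: ler_sum => w _; apply: ler_wpM2l => //.
  by have /andP[] := fab w.
by have /andP[] := fab w.
Qed.

Lemma drift_range t z : 0 <= drift t z <= t%:R.
Proof.
suff : mR z <= P t mR z <= mR z + t%:R by rewrite /drift; lra.
elim: t z => [|t IH] z; first by rewrite /P /= lexx addr0 lexx.
apply: (@U_range (P t mR)) => w; have := IH (step z w); have := mR_step z w.
by rewrite -natr1; lra.
Qed.

Lemma drift_D t z : drift (L + t) z = P L (drift t) z + drift L z.
Proof.
have := P_lin L 1 1 (drift t) mR z; rewrite !mul1r /drift P_D addrA => <-.
by congr (_ - _); apply: P_ext => y; rewrite !mul1r subrK.
Qed.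

(* The oscillation [D] of the drift over starting points satisfies
   [D (L + t) <= (1 - delta) * D t + L], whose fixed point is [L / delta]. *)
Lemma drift_osc t : exists a, forall z, a <= drift t z <= a + L%:R / delta.
Proof.
have d0 := delta_gt0; have d1 := delta_le1.
have Ld : L%:R <= L%:R / delta.
  by rewrite ler_pdivlMr// ler_piMr.
have [n] := ubnP t; elim: n t => // n IH t /ltnSE tn.
(* Below [L] the trivial range [[0, t]] suffices, as [t <= L <= L / delta]. *)
have [tL|Lt] := ltnP t L.
  exists 0 => z; have /andP[-> h] := drift_range t z; rewrite add0r /=.
  by apply: le_trans h (le_trans _ Ld); rewrite ler_nat ltnW.
have [|a /(contract (inv_drift _))[a' [b' [E H]]]] := IH (t - L)%N.
  by apply: leq_trans tn; rewrite ltn_subrL L_gt0 (leq_trans L_gt0 Lt).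
exists a' => z; rewrite -(subnKC Lt) drift_D.
have := H z; have := drift_range L z.
have : L%:R / delta * delta = L%:R by rewrite divfK// gt_eqF.
set D := L%:R / delta in E *; nra.
Qed.

(** * Concentration of the maximum *)

Let K : R := L%:R / delta + 1.

Let K_gt0 : 0 < K.
Proof. by rewrite ltr_wpDl// divr_ge0// ltW. Qed.

(** This bounds an increment of the Doob martingale with [t] steps left. Over all moves, the
    conditional means lie in a window of length [K]: the oscillation of the drift plus [1] for the
    rise of the maximum. Their average lies in it too. *)
Lemma mart_diff t z w : `|P t mR (step z w) - U (P t mR) z| <= K.
Proof.
have [a ha] := drift_osc t.
have rg w' : mR z + a <= P t mR (step z w') <= mR z + a + K.
  have := ha (step z w'); have := mR_step z w'; rewrite /drift /K.
  by move: (_ / delta) => D; lra.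
have := U_range rg; have := rg w; move: (P t mR _) (U _ _) => p u.
by rewrite ler_norml; lra.
Qed.

Lemma drift_mu t z : `|drift t z - mu (drift t)| <= K.
Proof.
have [a ha] := drift_osc t; have := mu_range (@inv_drift t) ha; have := ha z.
by rewrite ler_norml /K; move: (_ / delta) => D; lra.
Qed.

(** Azuma-Hoeffding: the first step is peeled off, and each step costs one factor [e^(2 lam^2 K^2)]
    by [U_expR]. *)
Lemma P_expR (lam : R) t z : P t (fun y => expR (lam * mR y)) z <=
  expR (lam * P t mR z + 2 * lam ^+ 2 * K ^+ 2 * t%:R).
Proof.
elim: t z => [|t IH] z; first by rewrite mulr0 addr0.
set c := 2 * _ * _; rewrite P_S.
apply: (@le_trans _ _ (expR (c * t%:R) * U (fun y => expR (lam * P t mR y)) z)).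
  rewrite /U mulr_sumr; apply: ler_sum => w _; rewrite mulrCA -expRD addrC.
  by apply: ler_wpM2l.
rewrite [leRHS](_ : _ = expR (c * t%:R) * expR (lam * U (P t mR) z + c)).
  by rewrite ler_pM2l ?expR_gt0//; apply: U_expR => w; exact: mart_diff.
by rewrite -expRD -natr1; congr expR; rewrite -[U (P t mR) z]/(P t.+1 mR z); ring.
Qed.

(** Chernoff's bound for both tails. The centre [a] is free because in equilibrium it is not the
    mean from the actual start [z]. *)
Lemma P_deviation (lam y a : R) t z : 0 <= lam ->
  P t (fun u => (y < `|mR u - a|)%R%:R) z <=
  expR (2 * lam ^+ 2 * K ^+ 2 * t%:R - lam * y) *
  (expR (lam * (P t mR z - a)) + expR (- lam * (P t mR z - a))).
Proof.
move=> lam0; set c := 2 * _ * _.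
apply: (@le_trans _ _ (expR (- lam * y - lam * a) * P t (fun u => expR (lam * mR u)) z +
    expR (- lam * y + lam * a) * P t (fun u => expR (- lam * mR u)) z)).
  rewrite -P_lin; apply: P_le => u; case: ltP => [|_]; last first.
    by rewrite addr_ge0// mulr_ge0// expR_ge0.
  rewrite -!expRD ltr_normr => /orP[h|h].
    apply: (@le_trans _ _ (expR (- lam * y - lam * a + lam * mR u))).
      by rewrite -[leLHS](@expR0 R) ler_expR; nra.
    by rewrite lerDl expR_ge0.
  apply: (@le_trans _ _ (expR (- lam * y + lam * a - lam * mR u))).
    by rewrite -[leLHS](@expR0 R) ler_expR; nra.
  by rewrite -mulNr lerDr expR_ge0.
have h1 := P_expR lam t z; have h2 := P_expR (- lam) t z.
rewrite sqrrN -/c in h1 h2; rewrite mulrDr -!expRD; apply: lerD.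
  rewrite [leRHS](_ : _ = expR (- lam * y - lam * a) * expR (lam * P t mR z + c * t%:R)).
    by rewrite ler_pM2l ?expR_gt0.
  by rewrite -expRD; congr expR; ring.
rewrite [leRHS](_ : _ = expR (- lam * y + lam * a) * expR (- lam * P t mR z + c * t%:R)).
  by rewrite ler_pM2l ?expR_gt0.
by rewrite -expRD; congr expR; ring.
Qed.

Let c0 : R := (8 * K ^+ 2)^-1.

(* Since [x / 0 = 0], the bound is the trivial one at [t = 0]. *)
Lemma cbound0 c y : cbound c y 0 = 2 :> R.
Proof. by rewrite /cbound mulr0 invr0 mulr0 oppr0 expR0 mulr1. Qed.

(* [lam = y / (8 K^2 t)] is the optimal choice for the exponent
   [4 lam^2 K^2 t - lam y]. *)
Lemma cbound_opt t (y : R) : (0 < t)%N -> 0 < y -> exists2 lam : R, 0 <= lam &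
  2 * expR (2 * lam ^+ 2 * K ^+ 2 * (t%:R + 1) - lam * y) <= cbound c0 y t.
Proof.
move=> t0 y0; have tR : (1 : R) <= t%:R by rewrite ler1n.
have K0 := K_gt0.
have K2 : 0 < K ^+ 2 by rewrite exprn_gt0.
exists (y / (8 * K ^+ 2 * t%:R)).
  by rewrite divr_ge0 ?ltW// !mulr_gt0//; lra.
rewrite /cbound ler_pM2l// ler_expR.
set lam := y / _.
(* Here [t + 1 <= 2 t]; the extra [1] is room for the random initial profile in equilibrium. *)
apply: (@le_trans _ _ (2 * lam ^+ 2 * K ^+ 2 * (2 * t%:R) - lam * y)).
  rewrite lerD2r; apply: ler_wpM2l; last by lra.
  by apply: mulr_ge0; [apply: mulr_ge0 => //|]; exact: sqr_ge0.
rewrite le_eqVlt; apply/orP; left; apply/eqP; rewrite /lam /c0.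
by field; rewrite ?gt_eqF//; lra.
Qed.

Lemma concentration t (y : R) z : 0 < y ->
  P t (fun u => (y < `|mR u - P t mR z|)%R%:R) z <= cbound c0 y t.
Proof.
move=> y0; case: (posnP t) => [->|t0].
  by rewrite cbound0; apply: P_ub => u; case: (_ < _) => //; rewrite ler1n.
have [lam lam0 H] := cbound_opt t0 y0; apply: le_trans H.
apply: le_trans (P_deviation _ _ _ _ lam0) _; rewrite subrr !mulr0 expR0 mulrC.
rewrite (_ : 1 + 1 = 2 :> R)// ler_pM2l// ler_expR lerD2r ler_wpM2l ?lerDl//.
by apply: mulr_ge0; [apply: mulr_ge0 => //|]; exact: sqr_ge0.
Qed.

Lemma esum_pi_mR t : (\esum_(x in [set: Z]%classic) (pi x * P t mR x)%:E =
  (mu (drift t))%:E)%E.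
Proof.
rewrite (@esum_pi _ t%:R) => [|z]; last by rewrite P_mR_red; exact: drift_range.
by congr (mu _)%:E; apply/funext => z; rewrite /= P_mR_red.
Qed.

(** Given the initial profile, [P_deviation] leaves exponentials of [drift t - a]. By [mu_expR]
    their equilibrium mean costs one further factor [e^(2 lam^2 K^2)], hence [t + 1] increments. *)
Lemma concentration_pi t (y : R) : 0 < y ->
  (\esum_(x in [set: Z]%classic)
    (pi x * P t (fun u => (y < `|mR u - mu (drift t)|)%R%:R) x)%:E <=
  (cbound c0 y t)%:E)%E.
Proof.
move=> y0; set a := mu (drift t); set g := P t _.
have g01 z : 0 <= g z <= 1.
  by apply: P_range => u; rewrite ler0n lern1 leq_b1.
rewrite (@esum_pi _ 1)// lee_fin.
have Ig : inv (g \o red) by move=> z; rewrite /= red_id.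
have g01' z : 0 <= (g \o red) z <= 1 by exact: g01.
case: (posnP t) => [t0|t0].
  by rewrite [X in cbound _ _ X]t0 cbound0; have /andP[_] := mu_range Ig g01'; lra.
have [lam lam0 H] := cbound_opt t0 y0; apply: le_trans H.
set E := expR (2 * lam ^+ 2 * K ^+ 2 * t%:R - lam * y).
pose ex (l : R) z := expR (l * (drift t z - a)).
have bd : bnd (drift t) by exact: range_bnd (drift_range t).
have Id := @inv_drift t.
have Iex l : inv (ex l) by move=> z; rewrite /ex Id.
have bex l : bnd (ex l).
  apply: (range_bnd (a := 0) (b := expR (`|l| * K))) => z.
  rewrite expR_ge0 ler_expR; apply: le_trans (ler_norm _) _.
  by rewrite normrM ler_wpM2l// drift_mu.
have mex l : mu (ex l) <= expR (2 * l ^+ 2 * K ^+ 2).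
  by apply: mu_expR => // z; exact: drift_mu.
apply: (@le_trans _ _ (mu (fun z => E * ex lam z + E * ex (- lam) z))).
  apply: mu_le => //; first exact: range_bnd g01'.
  - have [B1 h1] := bex lam; have [B2 h2] := bex (- lam).
    exists (E * B1 + E * B2) => z; apply: le_trans (ler_normD _ _) _.
    by rewrite !normrM ger0_norm ?expR_ge0// lerD// ler_wpM2l ?expR_ge0.
  - by move=> z; rewrite !Iex.
  - move=> z; rewrite -mulrDr /ex /drift -P_mR_red; exact: P_deviation.
rewrite mu_lin//; have := mex lam; have := mex (- lam); rewrite sqrrN.
have -> : 2 * lam ^+ 2 * K ^+ 2 * (t%:R + 1) - lam * y =
  (2 * lam ^+ 2 * K ^+ 2 * t%:R - lam * y) + 2 * lam ^+ 2 * K ^+ 2 by ring.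
have : 0 < E by exact: expR_gt0.
by rewrite expRD -/E; nra.
Qed.

Theorem chain_limit : exists q : Z -> R,
  [/\ (forall x, 0 <= q x) /\ (\esum_(x in [set: Z]%classic) (q x)%:E = 1)%E,
      (forall y, \esum_(x in [set: Z]%classic) (q x * U (ind y) x)%:E = (q y)%:E)%E,
      (forall z x, P t (ind x) z @[t --> \oo] --> q x)%classic,
      (exists2 c : R, 0 < c & forall t (y : R), 0 < y ->
        (\esum_(x in [set: Z]%classic) (q x * P t (fun u => (y < `|mR u -
            fine (\esum_(x in [set: Z]%classic) (q x * P t mR x)%:E)|)%R%:R) x)%:E <=
          (cbound c y t)%:E)%E /\
        forall z, P t (fun u => (y < `|mR u - P t mR z|)%R%:R) z <= cbound c y t) &
      exists C : R, forall z t,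
        `|fine (\esum_(x in [set: Z]%classic) (q x * P t mR x)%:E)%E -
          (P t mR z - mR z)| <= C].
Proof.
exists pi; split.
- by split; [exact: pi_ge0|exact: esum_pi1].
- exact: pi_invariant.
- by move=> z x; apply: cvg_P; [exact: bnd_ind|exact: inv_ind].
- exists c0; first by rewrite invr_gt0 mulr_gt0// exprn_gt0// K_gt0.
  move=> t y y0; split=> [|z]; last exact: concentration.
  by rewrite esum_pi_mR; exact: concentration_pi.
- exists K => z t; rewrite esum_pi_mR /= distrC; exact: drift_mu.
Qed.

End Chain.

(** * The two dropping models *)

Section Models.
Variables (R : realType) (V : finType) (e : rel V).
Implicit Types (h x : {ffun V -> int}) (v w : V) (t : nat).

Lemma sum_tupleS t (F : seq V -> R) :
  \sum_(s : t.+1.-tuple V) F s = \sum_(w : V) \sum_(s : t.-tuple V) F (w :: s).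
Proof.
rewrite pair_bigA /= (reindex (fun ws : V * t.-tuple V => [tuple of ws.1 :: ws.2])) //=.
exists (fun s : t.+1.-tuple V => (thead s, [tuple of behead s])) => [[w s] _|s _] /=.
  by congr pair; apply: val_inj.
by rewrite [RHS]tuple_eta; apply: val_inj.
Qed.

Lemma sum_tuple0 (F : seq V -> R) : \sum_(s : 0.-tuple V) F s = F [::].
Proof.
rewrite (big_pred1 [tuple])// => s /=; apply/esym/eqP; exact: tuple0.
Qed.

Definition stepI h w := Tdrop e w h.
Definition wtI (p : V -> R) h w := p w.

Lemma sum_wI (p : V -> R) t f h :
  \sum_(s : t.-tuple V) wI p s * f (drops e h s) = P stepI (wtI p) t f h.
Proof.
elim: t h => [|t IH] h.
  by rewrite (sum_tuple0 (fun s => wI p s * f (drops e h s))) /wI big_nil mul1r.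
rewrite (sum_tupleS _ (fun s => wI p s * f (drops e h s))) P_S.
apply: eq_bigr => w _; rewrite -IH mulr_sumr; apply: eq_bigr => s _.
by rewrite /wI big_cons mulrA.
Qed.

Definition stepM (z : {ffun V -> int} * V) w := (Tdrop e w z.1, w).
Definition wtM (A : V -> V -> R) (z : {ffun V -> int} * V) w := A z.2 w.
Definition redM (z : {ffun V -> int} * V) := (prof z.1, z.2).
Definition mxM (z : {ffun V -> int} * V) := mx z.1.

Lemma sum_wM (A : V -> V -> R) t f h v :
  \sum_(s : t.-tuple V) wM A v s * f (drops e h s, last v s) =
  P stepM (wtM A) t f (h, v).
Proof.
elim: t h v => [|t IH] h v.
  by rewrite (sum_tuple0 (fun s => wM A v s * f (drops e h s, last v s))) mul1r.
rewrite (sum_tupleS _ (fun s => wM A v s * f (drops e h s, last v s))) P_S.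
apply: eq_bigr => w _; rewrite -IH mulr_sumr; apply: eq_bigr => s _.
by rewrite /= mulrA.
Qed.

Lemma foldl_stepM s h v : foldl stepM (h, v) s = (drops e h s, last v s).
Proof. by elim: s h v => //= w s IH h v; rewrite IH. Qed.

Lemma admissible_path (A : V -> V -> R) h v s :
  admissible stepM (wtM A) (h, v) s = path (fun v w => 0 < A v w) v s.
Proof. by elim: s h v => //= w s IH h v; rewrite IH. Qed.

Lemma admissible_all (p : V -> R) h s : (forall i, 0 < p i) ->
  admissible stepI (wtI p) h s.
Proof. by move=> p0; elim: s h => //= w s IH h; rewrite p0 IH. Qed.

Lemma exists_min_weight (A : V -> V -> R) :
  exists2 eps, 0 < eps & forall v w, 0 < A v w -> eps <= A v w.
Proof.
exists (\big[Num.min/1]_(vw : V * V | 0 < A vw.1 vw.2) A vw.1 vw.2).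
  exact: lt_bigmin.
by move=> v w vw; exact: (@bigmin_le_cond _ _ _ _ (v, w) (fun vw => 0 < A vw.1 vw.2)).
Qed.

(** A positive sum of nonnegative products has a positive term, which supplies the last edge of a
    path. *)
Lemma Apow_connect (A : V -> V -> R) s v v' : (forall v v', 0 <= A v v') ->
  0 < Apow A s v v' -> connect (fun v w => 0 < A v w) v v'.
Proof.
move=> A0; have Ap0 k u u' : 0 <= Apow A k u u'.
  elim: k u' => [|k IH] u' /=; first by rewrite ler0n.
  by apply: sumr_ge0 => i _; rewrite mulr_ge0.
elim: s v' => [|s IH] v' /=; first by case: eqP => [->|]; rewrite ?ltxx.
move=> pos; have [/existsP[u /andP[su uv]]|] :=
    boolP [exists u, (0 < Apow A s v u) && (0 < A u v')].
  exact: connect_trans (IH _ su) (connect1 uv).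
rewrite negb_exists => /forallP none; move: pos; rewrite big1 ?ltxx// => u _.
have := none u; rewrite !lt_def A0 Ap0 !andbT negb_and !negbK.
by case/orP=> /eqP ->; rewrite ?mul0r ?mulr0.
Qed.

(** * Doeblin's condition for the two models *)

Hypotheses (e_sym : symmetric e) (e_conn : forall x y : V, connect e x y).

Lemma doeblinM (A : V -> V -> R) (v0 : V) :
  (forall v v', 0 <= A v v') -> (forall v, \sum_(v' : V) A v v' = 1) ->
  (forall v v', v != v' -> exists s, 0 < Apow A s v v') ->
  (forall v, 0 < A v v) ->
  exists L delta zs, [/\ (0 < L)%N, 0 < delta &
    forall z, delta <= P stepM (wtM A) L (ind R redM zs) z].
Proof.
move=> A0 A1 irr lazy; pose a v w := 0 < A v w.
have a_conn u u' : connect a u u'.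
  by have [->//|/irr[s]] := eqVneq u u'; exact: Apow_connect.
have [L [x [L0 H]]] := exists_universal_words e_sym e_conn lazy a_conn v0.
have [eps eps0 heps] := exists_min_weight A.
(* The universal word has [L] letters, each of probability at least [eps]. *)
exists L, (eps ^+ L), (x, v0); split => [//||[h v]]; first exact: exprn_gt0.
have [s [<- ps ls hs]] := H h v.
have adm : admissible stepM (wtM A) (h, v) s by rewrite admissible_path.
have := P_admissible (fun z => A0 z.2) (fun z => A1 z.2) (ltW eps0)
  (fun z => heps z.2) (f := ind R redM (x, v0)) (fun _ => ler0n _ _) adm.
by rewrite foldl_stepM {1}/ind /redM hs ls eqxx mulr1.
Qed.

(** Independent droppings may use any word, that is, any walk for the full relation. *)
Lemma doeblinI (p : V -> R) (v0 : V) : (forall i, 0 < p i) -> \sum_(i : V) p i = 1 ->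
  exists L delta zs, [/\ (0 < L)%N, 0 < delta &
    forall h, delta <= P stepI (wtI p) L (ind R (@prof V) zs) h].
Proof.
move=> p0 p1; have [L [x [L0 H]]] := exists_universal_words e_sym e_conn
  (a := fun _ _ => true) (fun _ => erefl) (fun _ _ => connect1 erefl) v0.
have [eps eps0 heps] := exists_min_weight (fun _ => p).
exists L, (eps ^+ L), x; split => [//||h]; first exact: exprn_gt0.
have [s [<- _ _ hs]] := H h v0.
have := P_admissible (fun _ i => ltW (p0 i)) (fun _ => p1) (ltW eps0)
  (fun _ => heps v0) (f := ind R (@prof V) x) (fun _ => ler0n _ _)
  (admissible_all h s p0).
by rewrite [foldl _ _ _](_ : _ = drops e h s)// {1}/ind hs eqxx mulr1.
Qed.

End Models.

Local Open Scope classical_set_scope.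

Theorem theorem1 (R : realType) (V : finType) (e : rel V)
  (e_sym : symmetric e) (e_irr : irreflexive e)
  (e_conn : forall x y : V, connect e x y)
  (V_gt2 : (2 < #|V|)%N) :
                             
  (forall p : V -> R,
     (forall i, 0 < p i) -> \sum_(i : V) p i = 1 ->
     exists pi : {ffun V -> int} -> R,
       [/\ (forall x, 0 <= pi x)
           /\ \esum_(x in [set: {ffun V -> int}]) (pi x)%:E = 1%E,
           invariantI e p pi,
                                                                       
           (forall h0 : {ffun V -> int}, (forall j, 0 <= h0 j) ->
              forall x : {ffun V -> int},
                (fun t => PI e p h0 t (fun h => prof h == x)) @ \oo --> pi x),
                                                                          
           (exists2 c : R, 0 < c &
              forall (t : nat) (y : R), 0 < y ->
                (PIpi e pi p t
                   (fun h => (y < `|(mx h)%:~R - fine (ExpIpi e pi p t)|)%R)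
                   <= (cbound c y t)%:E)%E
                /\ (forall h0 : {ffun V -> int}, (forall j, 0 <= h0 j) ->
                      PI e p h0 t (fun h => y < `|(mx h)%:~R - ExpI e p h0 t|)
                        <= cbound c y t)) &
                                             
           (exists C : R, forall t : nat,
              `|fine (ExpIpi e pi p t) - ExpI e p 0 t| <= C)])
  /\
                              
  (forall A : V -> V -> R,
     (forall v v', 0 <= A v v') -> (forall v, \sum_(v' : V) A v v' = 1) ->
     (forall v v', v != v' -> exists s, 0 < Apow A s v v') ->
     (forall v, 0 < A v v) ->
     exists pi : {ffun V -> int} * V -> R,
       [/\ (forall z, 0 <= pi z)
           /\ \esum_(z in [set: {ffun V -> int} * V]) (pi z)%:E = 1%E,
           invariantM e A pi,
           (forall (h0 : {ffun V -> int}) (v0 : V), (forall j, 0 <= h0 j) ->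
              forall (x : {ffun V -> int}) (v : V),
                (fun t => PM e A v0 h0 t (fun z => (prof z.1 == x) && (z.2 == v)))
                  @ \oo --> pi (x, v)),
           (exists2 c : R, 0 < c &
              forall (t : nat) (y : R), 0 < y ->
                (PMpi e pi A t
                   (fun z => (y < `|(mx z.1)%:~R - fine (ExpMpi e pi A t)|)%R)
                   <= (cbound c y t)%:E)%E
                /\ (forall (h0 : {ffun V -> int}) (v0 : V), (forall j, 0 <= h0 j) ->
                      PM e A v0 h0 t
                        (fun z => y < `|(mx z.1)%:~R - ExpM e A v0 h0 t|)
                        <= cbound c y t)) &
           (exists C : R, forall (v0 : V) (t : nat),
              `|fine (ExpMpi e pi A t) - ExpM e A v0 0 t| <= C)]).
Proof.
have /card_gt0P[v0 _] : (0 < #|V|)%N by exact: ltn_trans V_gt2.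
have mx0 : mx (0 : {ffun V -> int}) = 0.
  by have [m ->] := mx_attained v0 (0 : {ffun V -> int}); rewrite ffunE.
split=> [p p_gt0 p_sum1|A A_ge0 A_sum1 A_irr A_lazy].
- have [L [delta [zs [L0 delta0 doeb]]]] := doeblinI e_sym e_conn v0 p_gt0 p_sum1.
  have p_ge0 i : 0 <= p i by exact: ltW.
  have [q [q1 q_inv q_lim [c c0 q_conc] [C hC]]] := @chain_limit _ _ _ _ _
    (fun _ => p_ge0) (fun _ => p_sum1) (@prof V) (fun _ _ => erefl)
    (fun h w => prof_Tdrop_prof e w h) (@prof_id V) L delta zs L0 delta0 doeb
    (@mx V) (@mx_prof V v0) (fun h w => mx_Tdrop_prof e w h)
    (fun h w => ltac:(by rewrite le_mx_Tdrop mx_Tdrop_le)).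
  have PIE h t E : PI e p h t E = P (stepI e) (wtI p) t (fun h => (E h)%:R) h.
    by rewrite -sum_wI.
  have ExpIE h t : ExpI e p h t = P (stepI e) (wtI p) t (mR R (@mx V)) h.
    by rewrite -sum_wI.
  have ExpIpiE t : ExpIpi e q p t = \esum_(x in [set: {ffun V -> int}])
      (q x * P (stepI e) (wtI p) t (mR R (@mx V)) x)%:E.
    by apply: eq_esum => x _; rewrite ExpIE.
  exists q; split => //.
  + move=> h0 _ x; under eq_cvg do rewrite PIE; exact: q_lim.
  + exists c => // t y y0; have [h1 h2] := q_conc t y y0; split.
      rewrite /PIpi; under eq_esum do rewrite PIE.
      by rewrite ExpIpiE; exact: h1.
    by move=> h0 _; rewrite PIE ExpIE; exact: h2.
  (* The flat configuration has maximum [0], so its drift is its mean. *)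
  + exists C => t; have := hC 0 t; rewrite -ExpIE -ExpIpiE.
    by rewrite /mR mx0 subr0.
- have [L [delta [zs [L0 delta0 doeb]]]] :=
    doeblinM e_sym e_conn v0 A_ge0 A_sum1 A_irr A_lazy.
  have redM_step z w : redM (stepM e (redM z) w) = redM (stepM e z w).
    by rewrite /redM /stepM /= prof_Tdrop_prof.
  have redM_id (z : {ffun V -> int} * V) : redM (redM z) = redM z.
    by rewrite /redM /= prof_id.
  have [q [q1 q_inv q_lim [c c0 q_conc] [C hC]]] := @chain_limit _ _ _ _ _
    (fun z => A_ge0 z.2) (fun z => A_sum1 z.2) (@redM V) (fun _ _ => erefl)
    redM_step redM_id L delta zs L0 delta0 doeb
    (@mxM V) (fun z => mx_prof v0 z.1) (fun z w => mx_Tdrop_prof e w z.1)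
    (fun z w => ltac:(by rewrite /mxM le_mx_Tdrop mx_Tdrop_le)).
  have PME h v t E : PM e A v h t E = P (stepM e) (wtM A) t (fun z => (E z)%:R) (h, v).
    by rewrite -sum_wM.
  have ExpME h v t : ExpM e A v h t = P (stepM e) (wtM A) t (mR R (@mxM V)) (h, v).
    by rewrite -sum_wM.
  have ExpMpiE t : ExpMpi e q A t = \esum_(z in [set: {ffun V -> int} * V])
      (q z * P (stepM e) (wtM A) t (mR R (@mxM V)) z)%:E.
    by apply: eq_esum => -[h v] _; rewrite ExpME.
  exists q; split => //.
  + move=> y w; rewrite -q_inv; apply: eq_esum => z _; congr (_%:E).
    (* Only the move [w] itself leaves the driving chain at [w]. *)
    rewrite /U (bigD1 w)//= big1 ?addr0 => [|w' ww'].
      by rewrite mulrA /ind /redM /stepM /= xpair_eqE eqxx andbT.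
    by rewrite /ind /redM /stepM /= xpair_eqE (negbTE ww') andbF mulr0.
  + move=> h0 u0 _ x v; under eq_cvg do rewrite PME.
    exact: q_lim.
  + exists c => // t y y0; have [h1 h2] := q_conc t y y0; split.
      rewrite ExpMpiE; apply: le_trans h1; rewrite le_eqVlt; apply/orP; left; apply/eqP.
      by apply: eq_esum => -[h v] _; rewrite PME.
    by move=> h0 u0 _; rewrite PME ExpME; exact: h2.
  + exists C => u0 t; have := hC (0, u0) t; rewrite -ExpME -ExpMpiE.
    by rewrite /mR /mxM mx0 subr0.
Qed.
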